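(* Let $t$ be a positive constant with the following property (Z): there exists a set $\mathcal{P}_d$ of distributions supported on $\left[-\frac1{\sqrt d},\frac1{\sqrt d}\right]^d$ such that, if a centralized server wishes to estimate the mean of the underlying unknown distribution $p_d\in\mathcal{P}_d$ from which the clients' vectors are drawn i.i.d., then for any independent protocol $\pi$ with server output $\hat\theta_\pi$, $$\max_{p_d\in\mathcal{P}_d}\mathbb{E}\left[\left\|\theta(p_d)-\hat\theta_\pi\right\|_2^2\right]\ \ge\ t\min\left(1,\frac{d}{\mathcal{C}(\pi)}\right),$$ where $\theta(p_d)$ is the mean of $p_d$ and $\mathcal{C}(\pi)$ is the communication cost of the protocol. Then for every $c\le ndt/4$ (with $c>0$) and $n\ge4/t$, $$\mathcal{E}(\Pi(c),S^d)\;\ge\;\frac t4\min\left(1,\frac dc\right).$$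
   Context: (A universal constant $t$ having property (Z) for every $d$ exists by a known result on distributed statistical estimation of Zhang, Duchi, Jordan and Wainwright.) Distributed mean estimation: $n$ clients hold vectors $X^n=(X_1,\dots,X_n)$, $X_i\in\mathbb{R}^d$, with mean $\bar X=\frac1n\sum_{i=1}^nX_i$. $S^d=\{x\in\mathbb{R}^d:\|x\|_2\le1\}$ is the unit ball. An independent (simultaneous) protocol $\pi$: the clients independently send data to a server; client $i$ transmits a function $f(X_i)$ of its vector, and the server computes an estimate (denoted $\hat{\bar X}$, or $\hat\theta_\pi$) as some function of $f(X_1),\dots,f(X_n)$. Both private randomness (random values generated by each machine separately) and public randomness (a sequence of random values shared among all parties) may be used. $\mathcal{C}(\pi,X^n)$ is the expected total number of bits transmitted by all clients on input $X^n$, expectation being over the randomness of the protocol; the communication cost $\mathcal{C}(\pi)$ is its largest value over $X^n$ with all $X_i\in S^d$. $\mathcal{E}(\pi,X^n)=\mathbb{E}\|\hat{\bar X}-\bar X\|_2^2$; $\mathcal{E}(\pi,S^d)=\max\{\mathcal{E}(\pi,X^n):X_i\in S^d\ \forall i\}$; $\Pi(c)$ is the set of all independent protocols with $n$ clients and communication cost at most $c$; $\mathcal{E}(\Pi(c),S^d)=\min_{\pi\in\Pi(c)}\mathcal{E}(\pi,S^d)$ (max and min are to be read as sup and inf). *)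

(* Defs.v *)
From HB Require Import structures.
From mathcomp Require Import all_boot all_order all_algebra.
From mathcomp Require Import all_classical all_reals all_analysis.

Set Implicit Arguments.
Unset Strict Implicit.
Unset Printing Implicit Defensive.

Import Order.TTheory GRing.Theory Num.Theory.
Import numFieldNormedType.Exports.

Local Open Scope classical_set_scope.
Local Open Scope ring_scope.

(* Row vectors carry the sigma-algebra generated by the coordinates; over a   *)
(* realType this is the Borel sigma-algebra.                                  *)

Definition measure_rV_display : measure_display -> measure_display.
Proof. exact. Qed.

Section measurable_rV.
Context {d : measure_display} {T : sigmaRingType d} (n : nat).

Let coords : 'I_n -> 'rV[T]_n -> T := fun j x => x ord0 j.

Let rV_set0 : g_sigma_preimage coords set0.
Proof. exact: sigma_algebra0. Qed.

Let rV_setC A : g_sigma_preimage coords A -> g_sigma_preimage coords (~` A).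
Proof. exact: sigma_algebraC. Qed.

Let rV_bigcup (F : (set 'rV[T]_n)^nat) :
  (forall i, g_sigma_preimage coords (F i)) ->
  g_sigma_preimage coords (\bigcup_i (F i)).
Proof. exact: sigma_algebra_bigcup. Qed.

HB.instance Definition _ := @isMeasurable.Build (measure_rV_display d)
  'rV[T]_n (g_sigma_preimage coords) rV_set0 rV_setC rV_bigcup.

End measurable_rV.

Section product_probability.
Context {d : measure_display} {T : measurableType d} {R : realType}.

Definition tcons (n : nat) (x : T * n.-tuple T) : n.+1.-tuple T :=
  [tuple of x.1 :: x.2].

Lemma measurable_tcons (n : nat) : measurable_fun setT (@tcons n).
Proof. exact: measurable_cons. Qed.

HB.instance Definition _ (n : nat) :=
  isMeasurableFun.Build _ _ _ _ (@tcons n) (@measurable_tcons n).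

(* The product P 0 (x) ... (x) P (n - 1), i.e. the law of a tuple of          *)
(* independent random elements, the i-th of which has law P i.                *)
Fixpoint tuple_prob (n : nat) :
    ('I_n -> probability T R) -> probability (n.-tuple T) R :=
  match n with
  | 0 => fun _ => \d_([tuple])
  | n'.+1 => fun P =>
      distribution (P ord0 \x tuple_prob (fun i => P (lift ord0 i)))%E
        (@tcons n')
  end.

End product_probability.

Section distributed_mean_estimation.
Context {R : realType}.

(* `|x| is the sup norm on row vectors, hence an explicit Euclidean norm. *)
Definition norm2 (d : nat) (x : 'rV[R]_d) : R :=
  Num.sqrt (\sum_(j < d) x ord0 j ^+ 2).

Definition unit_ball (d : nat) : set 'rV[R]_d := [set x | norm2 x <= 1].

Definition cube (d : nat) : set 'rV[R]_d :=
  [set x | forall j, - (1 / Num.sqrt d%:R) <= x ord0 j <= 1 / Num.sqrt d%:R].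

Definition empirical_mean (n d : nat) (X : n.-tuple 'rV[R]_d) : 'rV[R]_d :=
  n%:R^-1 *: \sum_(i < n) tnth X i.

Definition mean (d : nat) (p : probability 'rV[R]_d R) : 'rV[R]_d :=
  \row_(j < d) (\int[p]_x (x ord0 j)).

(* An independent protocol with n clients holding vectors of R^d.  The public *)
(* random value is seen by every client and by the server; the server and     *)
(* each client also draw a private random value, all of them independent (see *)
(* rand_law).  Messages are finite bit strings.  The sigma-algebra on the     *)
(* countable set of messages is the discrete one, so measurability is stated  *)
(* message by message.                                                        *)
Record protocol (n d : nat) := Protocol {
  pub_disp : measure_display;
  pub : measurableType pub_disp;
  pub_law : probability pub R;
  srv_disp : measure_display;
  srv : measurableType srv_disp;
  srv_law : probability srv R;
  priv_disp : measure_display;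
  priv : measurableType priv_disp;
  priv_law : 'I_n -> probability priv R;
  encode : 'I_n -> pub -> priv -> 'rV[R]_d -> seq bool;
  decode : pub -> srv -> n.-tuple (seq bool) -> 'rV[R]_d;
  measurable_encode : forall (i : 'I_n) (m : seq bool),
    measurable [set a : pub * priv * 'rV[R]_d | encode i a.1.1 a.1.2 a.2 = m];
  measurable_decode : forall m : n.-tuple (seq bool),
    measurable_fun [set: pub * srv] (fun a => decode a.1 a.2 m)
}.

Section risk.
Context {n d : nat} (prot : protocol n d).

Definition rand : Type := (pub prot * srv prot * n.-tuple (priv prot))%type.

Definition rand_law :=
  ((pub_law prot \x srv_law prot) \x tuple_prob (@priv_law _ _ prot))%E.

Definition message (w : rand) (X : n.-tuple 'rV[R]_d) (i : 'I_n) : seq bool :=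
  encode i w.1.1 (tnth w.2 i) (tnth X i).

Definition estimate (w : rand) (X : n.-tuple 'rV[R]_d) : 'rV[R]_d :=
  decode w.1.1 w.1.2 [tuple message w X i | i < n].

Local Open Scope ereal_scope.

Definition expected_bits (X : n.-tuple 'rV[R]_d) : \bar R :=
  \int[rand_law]_w (\sum_(i < n) size (message w X i))%:R%:E.

Definition comm_cost : \bar R :=
  ereal_sup [set expected_bits X | X in
    [set X | forall i, @unit_ball d (tnth X i)]].

Definition mse (X : n.-tuple 'rV[R]_d) : \bar R :=
  \int[rand_law]_w (norm2 (estimate w X - empirical_mean X) ^+ 2)%:E.

Definition worst_mse : \bar R :=
  ereal_sup [set mse X | X in [set X | forall i, @unit_ball d (tnth X i)]].

Definition statistical_risk (p : probability 'rV[R]_d R) : \bar R :=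
  \int[tuple_prob (fun _ : 'I_n => p) \x rand_law]_a
    (norm2 (mean p - estimate a.2 a.1) ^+ 2)%:E.

End risk.

Local Open Scope ereal_scope.

Definition minimax_mse (n d : nat) (c : R) : \bar R :=
  ereal_inf [set e | exists2 prot : protocol n d,
    comm_cost prot <= c%:E & worst_mse prot = e].

(* In \bar R, d / 0 = +oo (for d > 0) and d / +oo = 0, so the right-hand side *)
(* is meaningful for every communication cost.                                *)
Definition property_Z (d : nat) (t : R) : Prop :=
  exists Pd : set (probability 'rV[R]_d R),
    (forall p, Pd p -> p (@cube d) = 1) /\
    (forall (n : nat) (prot : protocol n d), (0 < n)%N ->
       t%:E * mine 1 (d%:R%:E / comm_cost prot) <=
         ereal_sup [set statistical_risk prot p | p in Pd]).

End distributed_mean_estimation.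

(* Main.v *)
(* Every law supported on the cube of half-side 1/sqrt d is supported on the
   unit ball, so a protocol estimating the empirical mean can also be used to
   estimate the mean theta of an unknown law from n i.i.d. samples.  From
   |theta - est|^2 <= 2 |theta - Xbar|^2 + 2 |est - Xbar|^2 and
   E |theta - Xbar|^2 <= 1/n, the statistical risk is at most
   2/n + 2 (worst-case error); property (Z) bounds it from below by
   t min(1, d/c), and both conditions on n give 1/n <= t/4 min(1, d/c). *)
Require Import Defs.
From mathcomp Require Import all_boot all_order all_algebra.
From mathcomp Require Import all_classical all_reals all_analysis.
From mathcomp Require Import measurable_realfun.
From mathcomp Require Import ring lra.

Set Implicit Arguments.
Unset Strict Implicit.
Unset Printing Implicit Defensive.

Import Order.TTheory GRing.Theory Num.Theory.
Local Open Scope classical_set_scope.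
Local Open Scope ring_scope.

(** * Measurability by countable cases, and integrals bounded on a set of full measure *)

(** The preimage of [Y] is the countable union over [i] of the pieces of [{c = i}] on which [F i]
    lands in [Y]. *)
Lemma measurable_fun_countable_glue (d d' : measure_display)
    (T : measurableType d) (T' : measurableType d') (I : countType)
    (c : T -> I) (F : I -> T -> T') :
  (forall i, measurable [set x | c x = i]) ->
  (forall i, measurable_fun setT (F i)) ->
  measurable_fun setT (fun x => F (c x) x).
Proof.
move=> mc mF _ Y mY; rewrite setTI.
rewrite (_ : _ @^-1` _ = \bigcup_i ([set x | c x = i] `&` F i @^-1` Y)).
  apply: countable_bigcupT_measurable => // i; apply: measurableI => //.
  by rewrite -[X in measurable X]setTI; exact: mF.
apply/seteqP; split => [x /= Yx|x [i _ [/= <-]]//].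
by exists (c x).
Qed.

(** The complement of [A] is null, so only the integral over [A] remains, at most [M * P A]. Bounds
    valid only on the cube thus apply to any law supported there. *)
Lemma ae_integral_le_cst (d : measure_display) (T : measurableType d)
    (R : realType) (P : probability T R) (A : set T) (h : T -> \bar R)
    (M : \bar R) :
  measurable A -> P A = 1%E -> measurable_fun setT h ->
  (forall x, 0 <= h x)%E -> (forall x, A x -> h x <= M)%E ->
  (\int[P]_x h x <= M)%E.
Proof.
move=> mA PA mh h0 hM.
have mAC : measurable (~` A) by exact: measurableC.
rewrite (ge0_negligible_integral mAC)//; last first.
  by transitivity (1 - P A)%E; [exact: probability_setC|rewrite PA subee].
rewrite setTD setCK -[leRHS]mule1 -PA -integral_cst//.
apply: ge0_le_integral => //; exact: measurable_funTS.
Qed.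

(** * Tuples of i.i.d. samples and the variance of their sum *)

Section iid.
Context {d : measure_display} {T : measurableType d} {R : realType}.
Context (p : probability T R).

Let tp n := tuple_prob (fun _ : 'I_n => p).

Lemma ge0_integral_tuple_probS (n : nat) (f : n.+1.-tuple T -> \bar R) :
  measurable_fun setT f -> (forall x, 0 <= f x)%E ->
  (\int[tp n.+1]_x f x = \int[tp n]_x \int[p]_y f (tcons (y, x)))%E.
Proof.
move=> mf f0; rewrite ge0_integral_distribution// fubini_tonelli2//=.
  by apply: measurableT_comp => //; exact: measurable_tcons.
Qed.

Lemma measurable_tuple_all (n : nat) (A : set T) : measurable A ->
  measurable [set x : n.-tuple T | forall i, A (tnth x i)].
Proof.
move=> mA.
rewrite (_ : [set _ | _] = \bigcap_(i : 'I_n) ((@tnth _ T ^~ i) @^-1` A)).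
  apply: fin_bigcap_measurable => // i _.
  by rewrite -[X in measurable X]setTI; exact: measurable_tnth.
by apply/seteqP; split => x /= h i; [move=> _; exact: h|exact: (h i)].
Qed.

Lemma tuple_prob_all (n : nat) (A : set T) : measurable A -> p A = 1%E ->
  tp n [set x | forall i, A (tnth x i)] = 1%E.
Proof.
move=> mA pA; elim: n => [|n IH].
  by rewrite [LHS]diracE mem_set// => -[].
(* Pulled back along [tcons], the event is a rectangle, so its probability factors. *)
rewrite [LHS](_ : _ =
    (p \x tp n)%E (A `*` [set x : n.-tuple T | forall i, A (tnth x i)])).
  by rewrite product_measure1E//= ?pA ?IH ?mule1//; exact: measurable_tuple_all.
rewrite /= /distribution /pushforward; congr (_ _).
apply/seteqP; split => [[y x]/= h|[y x]/= [Ay h] i].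
  by split=> [|i]; [have := h ord0|have := h (lift ord0 i); rewrite tnthS].
by case: (unliftP ord0 i) => [j ->|->]//; rewrite tnthS.
Qed.

Context (f : T -> R).
Context (if1 : p.-integrable setT (EFin \o f)).
Context (if2 : p.-integrable setT (EFin \o (fun x => f x ^+ 2))).

Let m1 := \int[p]_x f x.
Let m2 := \int[p]_x (f x ^+ 2).

Let mf : measurable_fun setT f.
Proof. by apply/measurable_EFinP; exact: measurable_int if1. Qed.

(** Expand the square and use linearity. The shift is arbitrary: [s = - m1] gives the variance, and
    [- m1] plus the sum over the other samples gives the induction step below. *)
Lemma integral_sqr_shift (s : R) :
  (\int[p]_x ((f x + s) ^+ 2)%:E = (m2 + 2 * s * m1 + s ^+ 2)%:E)%E.
Proof.
have i1 : p.-integrable setT (EFin \o (fun x => 2 * s * f x)).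
  by apply: eq_integrable (integrableZl measurableT (2 * s) if1).
have i0 : p.-integrable setT (EFin \o cst (s ^+ 2)).
  exact: finite_measure_integrable_cst.
have i2 : p.-integrable setT (EFin \o (fun x => f x ^+ 2 + 2 * s * f x)).
  by apply: eq_integrable (integrableD measurableT if2 i1).
have i3 : p.-integrable setT (EFin \o (fun x => f x ^+ 2 + 2 * s * f x + s ^+ 2)).
  by apply: eq_integrable (integrableD measurableT i2 i0).
transitivity (\int[p]_x (f x ^+ 2 + 2 * s * f x + s ^+ 2))%:E.
  rewrite /Rintegral fineK; last exact: integrable_fin_num.
  by apply: eq_integral => x _; congr _%:E; ring.
congr _%:E; rewrite RintegralD// RintegralD// RintegralZl//.
rewrite Rintegral_cst// [X in fine X](_ : _ = 1%E) ?mulr1//.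
exact: probability_setT.
Qed.

(* Tonelli with the new sample integrated first: [integral_sqr_shift] then
   applies to each fixed value of the remaining sum, so that the cross term
   vanishes and no integrability on the product space is needed. *)
Lemma integral_sqr_centered_sum (n : nat) :
  (\int[tp n]_x ((\sum_(i < n) (f (tnth x i) - m1)) ^+ 2)%:E
    = (n%:R * (m2 - m1 ^+ 2))%:E)%E.
Proof.
have mS k : measurable_fun setT
    (fun x : k.-tuple T => \sum_(i < k) (f (tnth x i) - m1)).
  apply: measurable_sum => i; apply: measurable_funB => //.
  apply: measurableT_comp => //; exact: measurable_tnth.
have mS2 k : measurable_fun setT
    (fun x : k.-tuple T => ((\sum_(i < k) (f (tnth x i) - m1)) ^+ 2)%:E).
  apply: measurableT_comp; [exact: EFin_measurable|].
  by apply: measurable_funX; exact: mS.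
elim: n => [|n IH].
  by rewrite mul0r integral0_eq// => x _; rewrite big_ord0 expr0n.
rewrite ge0_integral_tuple_probS; last 2 first.
- exact: mS2.
- by move=> x; rewrite lee_fin sqr_ge0.
(* The variance is the integral of a square; its sign is what allows [ge0_integralD] on the constant
   summand. *)
have m2_ge : 0 <= m2 - m1 ^+ 2.
  rewrite -lee_fin; have := integral_sqr_shift (- m1).
  rewrite (_ : m2 + _ + _ = m2 - m1 ^+ 2); last by ring.
  by move=> <-; apply: integral_ge0 => x _; rewrite lee_fin sqr_ge0.
transitivity (\int[tp n]_x ((m2 - m1 ^+ 2)%:E +
    ((\sum_(i < n) (f (tnth x i) - m1)) ^+ 2)%:E))%E.
  apply: eq_integral => x _.
  under eq_integral => y _.
    rewrite big_ord_recl tnth0 /=.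
    under eq_bigr do rewrite tnthS.
    rewrite -addrA; over.
  by rewrite /= integral_sqr_shift -EFinD; congr _%:E; ring.
rewrite ge0_integralD//.
- rewrite IH integral_cst// [X in (_ * X)%E](_ : _ = 1%E) ?mule1; last first.
    exact: probability_setT.
  rewrite -EFinD -natr1; by congr _%:E; ring.
- by move=> x _; rewrite lee_fin sqr_ge0.
- exact: mS2.
Qed.

End iid.

(** * Euclidean norm, cube and unit ball *)

Section euclidean.
Context {R : realType} {d : nat}.
Implicit Types x y : 'rV[R]_d.

Lemma norm2_sqr x : norm2 x ^+ 2 = \sum_(j < d) x ord0 j ^+ 2.
Proof. by rewrite sqr_sqrtr// sumr_ge0// => j _; exact: sqr_ge0. Qed.

Lemma norm2_sqrB_le x y z :
  norm2 (x - z) ^+ 2 <= 2 * norm2 (x - y) ^+ 2 + 2 * norm2 (z - y) ^+ 2.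
Proof.
rewrite !norm2_sqr !mulr_sumr -big_split; apply: ler_sum => j _.
rewrite !mxE /=; move: (x ord0 j) (y ord0 j) (z ord0 j) => a b c.
(* Parallelogram identity: with u = a - b and v = c - b, the slack 2u^2 + 2v^2 - (u - v)^2 is (u +
   v)^2. *)
by have := sqr_ge0 (a + c - 2 * b); lra.
Qed.

Lemma measurable_coord (j : 'I_d) : measurable_fun setT (fun x => x ord0 j).
Proof.
move=> _ Y mY; rewrite setTI; apply: sub_sigma_algebra => /=.
rewrite -bigcup_seq/=; exists j => /=; first by rewrite mem_index_enum.
by exists Y => //; rewrite setTI.
Qed.

Lemma cube_coord_sqr x j : cube x -> x ord0 j ^+ 2 <= d%:R^-1.
Proof.
move=> /(_ j); rewrite div1r -ler_norml => xj.
rewrite -real_normK ?num_real// -[leRHS]sqr_sqrtr ?invr_ge0//.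
by rewrite sqrtrV// ler_pXn2r ?nnegrE.
Qed.

(** There are [d] coordinates, each with square at most 1/d. *)
Lemma cube_unit_ball : @cube R d `<=` unit_ball (d := d).
Proof.
move=> x xc; rewrite /unit_ball/= -(ler_pXn2r (n := 2)) ?nnegrE ?sqrtr_ge0//.
rewrite norm2_sqr expr1n; apply: le_trans (_ : \sum_(j < d) d%:R^-1 <= 1).
  by apply: ler_sum => j _; exact: cube_coord_sqr.
(* The product of [d%:R^-1] and [d%:R] is 1, except at [d = 0], where it is 0. *)
rewrite sumr_const card_ord -[leLHS]mulr_natr; have [->|d0] := eqVneq d 0%N.
  by rewrite mulr0.
by rewrite mulVf// pnatr_eq0.
Qed.

Lemma measurable_cube : measurable (@cube R d).
Proof.
rewrite (_ : cube (d := d) = \bigcap_(j : 'I_d) ((fun x => x ord0 j) @^-1`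
    `[- (1 / Num.sqrt d%:R), 1 / Num.sqrt d%:R])).
  apply: fin_bigcap_measurable => // j _.
  by rewrite -[X in measurable X]setTI; apply: measurable_coord.
by apply/seteqP; split => x /= h j; [move=> _|have := h j I];
  rewrite ?in_itv//=; exact: h.
Qed.

Lemma measurable_norm2_sqr (d' : measure_display) (T : measurableType d')
    (f : T -> 'rV[R]_d) :
  (forall j, measurable_fun setT (fun w => f w ord0 j)) ->
  measurable_fun setT (fun w => (norm2 (f w) ^+ 2)%:E).
Proof.
move=> mf; under eq_fun do rewrite norm2_sqr.
apply: measurableT_comp; [exact: EFin_measurable|].
by apply: measurable_sum => j; exact: measurable_funX.
Qed.

End euclidean.

(** * Mean squared error of the empirical mean *)

Section empirical_mean.
Context {R : realType} {d : nat}.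
Context (p : probability 'rV[R]_d R).
Context (pcube : p (@cube R d) = 1%E).

Let coord (j : 'I_d) (x : 'rV[R]_d) : R := x ord0 j.

Let mcoord2 (j : 'I_d) : measurable_fun setT (fun x => (coord j x ^+ 2)%:E).
Proof.
apply: measurableT_comp; [exact: EFin_measurable|].
by apply: measurable_funX; exact: measurable_coord.
Qed.

Lemma integral_coord_sqr_le (j : 'I_d) :
  (\int[p]_x (coord j x ^+ 2)%:E <= (d%:R^-1)%:E)%E.
Proof.
apply: (ae_integral_le_cst measurable_cube) => // x.
  by rewrite lee_fin sqr_ge0.
by rewrite lee_fin; exact: cube_coord_sqr.
Qed.

Lemma integrable_coord_sqr (j : 'I_d) :
  p.-integrable setT (EFin \o (fun x => coord j x ^+ 2)).
Proof.
apply/integrableP; split; first exact: mcoord2.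
apply: le_lt_trans (ltry d%:R^-1).
under eq_integral do rewrite /= ger0_norm ?sqr_ge0//.
exact: integral_coord_sqr_le.
Qed.

Lemma integrable_coord (j : 'I_d) : p.-integrable setT (EFin \o coord j).
Proof.
have i1 : p.-integrable setT (EFin \o cst 1).
  exact: finite_measure_integrable_cst.
(* Domination by 1 + a^2, which is at least |a|. *)
apply: le_integrable (integrableD measurableT i1 (integrable_coord_sqr j)) => //.
  by apply: measurableT_comp; [exact: EFin_measurable|exact: measurable_coord].
move=> x _ /=.
rewrite lee_fin [leRHS]ger0_norm ?addr_ge0 ?sqr_ge0//.
by rewrite ler_norml; apply/andP; split; nra.
Qed.

(** Coordinate by coordinate, the error is a centered i.i.d. sum divided by [n], up to sign. Its
    second moment is the variance over [n], at most 1/(nd), and there are [d] coordinates. *)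
Lemma empirical_mean_mse_le (n : nat) : (0 < n)%N ->
  (\int[tuple_prob (fun _ : 'I_n => p)]_X
    (norm2 (mean p - empirical_mean X) ^+ 2)%:E <= (n%:R^-1)%:E)%E.
Proof.
move=> n0; have nz : n%:R != 0 :> R by rewrite pnatr_eq0 -lt0n.
pose m j := \int[p]_x coord j x.
pose S j (X : n.-tuple 'rV[R]_d) := \sum_(i < n) (coord j (tnth X i) - m j).
have mS j : measurable_fun setT (fun X => (S j X ^+ 2)%:E).
  apply: measurableT_comp; [exact: EFin_measurable|].
  apply: measurable_funX; apply: measurable_sum => i; apply: measurable_funB => //.
  apply: measurableT_comp; [exact: measurable_coord|exact: measurable_tnth].
rewrite [leLHS](_ : _ = \int[tuple_prob (fun _ : 'I_n => p)]_X
    \sum_(j < d) ((n%:R^-1 ^+ 2)%:E * (S j X ^+ 2)%:E))%E; last first.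
  apply: eq_integral => X _; rewrite norm2_sqr -sumEFin.
  apply: eq_bigr => j _; rewrite -EFinM; congr _%:E.
  rewrite !mxE -exprMn -sqrrN; congr (_ ^+ 2).
  rewrite /S sumrB sumr_const card_ord summxE -/(m j) -[m j *+ n]mulr_natl.
  by rewrite mulrBr mulKf// opprB.
rewrite ge0_integral_sum//; last 2 first.
- by move=> j; exact: measurable_funeM.
- by move=> j x _; rewrite mule_ge0// lee_fin ?sqr_ge0.
apply: (@le_trans _ _ (\sum_(j < d) (n%:R^-1 * d%:R^-1)%:E)%E).
  apply: lee_sum => j _; rewrite ge0_integralZl_EFin ?sqr_ge0//; last first.
    by move=> X _; rewrite lee_fin sqr_ge0.
  rewrite integral_sqr_centered_sum; last 2 first.
  - exact: integrable_coord.
  - exact: integrable_coord_sqr.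
  have : \int[p]_x (coord j x ^+ 2) <= d%:R^-1.
    rewrite -lee_fin /Rintegral fineK; first exact: integral_coord_sqr_le.
    exact: integrable_fin_num (integrable_coord_sqr j).
  rewrite -EFinM lee_fin expr2 -!mulrA mulKf// ler_pM2l ?invr_gt0 ?ltr0n//.
  (* The variance is bounded by the second moment, dropping the squared mean. *)
  by have := sqr_ge0 (\int[p]_x coord j x); lra.
rewrite sumEFin lee_fin sumr_const card_ord -mulrnAr ler_piMr ?invr_ge0//.
have [->|d0] := eqVneq d 0%N; first by rewrite mulr0n.
by rewrite -[leLHS]mulr_natr mulVf// pnatr_eq0.
Qed.

End empirical_mean.

(** Transfer from worst-case error to statistical risk, for any measurable estimator [e] with
    randomness [Q] independent of the samples. *)
Lemma iid_risk_le (R : realType) (n d : nat) (p : probability 'rV[R]_d R)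
    (dW : measure_display) (W : measurableType dW) (Q : probability W R)
    (e : n.-tuple 'rV[R]_d * W -> 'rV[R]_d) (M : \bar R) :
  (0 < n)%N -> p (@cube R d) = 1%E -> measurable_fun setT e ->
  (forall X : n.-tuple 'rV[R]_d, (forall i, unit_ball (tnth X i)) ->
    \int[Q]_w (norm2 (e (X, w) - empirical_mean X) ^+ 2)%:E <= M)%E ->
  (\int[tuple_prob (fun _ : 'I_n => p) \x Q]_a (norm2 (mean p - e a) ^+ 2)%:E
    <= (2 / n%:R)%:E + 2%:E * M)%E.
Proof.
move=> n0 pcube me eM.
have mmean j : measurable_fun setT
    (fun X : n.-tuple 'rV[R]_d => empirical_mean X ord0 j).
  under eq_fun do rewrite mxE summxE.
  apply: measurable_funM => //; apply: measurable_sum => i.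
  exact: (measurableT_comp (measurable_coord j) (measurable_tnth i)).
have mej j : measurable_fun setT (fun a => e a ord0 j).
  exact: (measurableT_comp (measurable_coord j) me).
pose D (X : n.-tuple 'rV[R]_d) := (norm2 (mean p - empirical_mean X) ^+ 2)%:E.
pose E (a : n.-tuple 'rV[R]_d * W) :=
  (norm2 (e a - empirical_mean a.1) ^+ 2)%:E.
have mD : measurable_fun setT D.
  apply: measurable_norm2_sqr => j.
  under eq_fun do rewrite mxE [X in _ + X]mxE.
  by apply: measurable_funB.
have mDa : measurable_fun setT (fun a : n.-tuple 'rV[R]_d * W => D a.1).
  exact: measurableT_comp.
have mE : measurable_fun setT E.
  apply: measurable_norm2_sqr => j.
  under eq_fun do rewrite mxE [X in _ + X]mxE.
  apply: measurable_funB => //.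
  by apply: (measurableT_comp (mmean j)).
have D0 X : (0 <= D X)%E by rewrite lee_fin sqr_ge0.
have E0 a : (0 <= E a)%E by rewrite lee_fin sqr_ge0.
apply: (@le_trans _ _ (\int[tuple_prob (fun _ : 'I_n => p) \x Q]_a
   (2%:E * D a.1 + 2%:E * E a))%E).
  apply: ge0_le_integral => //.
  - by move=> a _; rewrite lee_fin sqr_ge0.
  - apply: measurable_norm2_sqr => j.
    under eq_fun do rewrite mxE [X in _ + X]mxE.
    by apply: measurable_funB.
  - by apply: emeasurable_funD; exact: measurable_funeM.
  - by move=> a _; rewrite -!EFinM -EFinD lee_fin; exact: norm2_sqrB_le.
rewrite ge0_integralD//; last 4 first.
- by move=> a _; rewrite mule_ge0.
- exact: measurable_funeM.
- by move=> a _; rewrite mule_ge0.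
- exact: measurable_funeM.
rewrite !ge0_integralZl_EFin//.
apply: leeD.
  (* [D] ignores the randomness, so the inner integral over [Q] has factor 1. *)
  rewrite fubini_tonelli1// EFinM lee_pmul2l//.
  apply: le_trans (empirical_mean_mse_le pcube n0).
  rewrite le_eqVlt; apply/orP; left; apply/eqP; apply: eq_integral => X _.
  rewrite /fubini_F /= integral_cst// [X in (_ * X)%E](_ : _ = 1%E) ?mule1//.
  exact: probability_setT.
(* With the samples fixed, the inner integral is the error on that input, at most [M] as soon as all
   samples lie in the cube, which happens with probability 1. *)
rewrite lee_pmul2l// fubini_tonelli1//.
apply: (ae_integral_le_cst (measurable_tuple_all measurable_cube)
  (tuple_prob_all n measurable_cube pcube)).
- exact: measurable_fun_fubini_tonelli_F.
- by move=> X; apply: integral_ge0 => w _; exact: E0.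
- by move=> X XA; apply: eM => i; exact: cube_unit_ball.
Qed.

(** * Measurability, cost and risk of a protocol *)

Section protocol_risk.
Context {R : realType} {n d : nat} (prot : protocol (R := R) n d).

Let sample : Type :=
  (n.-tuple 'rV[R]_d * (pub prot * srv prot * n.-tuple (priv prot)))%type.

Lemma measurable_message_eq (i : 'I_n) (s : seq bool) :
  measurable [set a : sample | message a.2 a.1 i = s].
Proof.
pose g (a : sample) := ((a.2.1.1, tnth a.2.2 i), tnth a.1 i).
have mg : measurable_fun setT g.
  apply: measurable_fun_pair.
    apply: measurable_fun_pair.
      by do 2 (apply: measurableT_comp => //).
    apply: (measurableT_comp (measurable_tnth i)).
    by apply: measurableT_comp => //.
  by apply: (measurableT_comp (measurable_tnth i)).
have := mg measurableT _ (measurable_encode i s).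
by rewrite setTI.
Qed.

Lemma measurable_messages_eq (m : n.-tuple (seq bool)) :
  measurable [set a : sample | [tuple message a.2 a.1 i | i < n] = m].
Proof.
rewrite (_ : [set _ | _] =
    \bigcap_(i : 'I_n) [set a : sample | message a.2 a.1 i = tnth m i]).
  by apply: fin_bigcap_measurable => // i _; exact: measurable_message_eq.
apply/seteqP; split => [a /= <- i _|a h]; first by rewrite tnth_mktuple.
by apply: eq_from_tnth => i; rewrite tnth_mktuple; exact: h.
Qed.

(** Message tuples form a countable type and the decoder is measurable for each fixed tuple. Joint
    measurability in samples and randomness is what Tonelli requires. *)
Lemma measurable_estimate :
  measurable_fun setT (fun a : sample => estimate a.2 a.1).
Proof.
have := @measurable_fun_countable_glue _ _ _ _ (n.-tuple (seq bool))
  (fun a : sample => [tuple message a.2 a.1 i | i < n])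
  (fun m a => Defs.decode a.2.1.1 a.2.1.2 m).
apply; first exact: measurable_messages_eq.
move=> m; apply: (measurableT_comp (measurable_decode (p := prot) m)).
by apply: measurableT_comp.
Qed.

(** A supremum over an empty set would be -oo; the all-zero input shows that the set is
    inhabited. *)
Lemma comm_cost_ge0 : (0 <= comm_cost prot)%E.
Proof.
apply: le_ereal_sup_tmp.
exists (expected_bits prot [tuple (0 : 'rV[R]_d) | _ < n]).
  exists [tuple (0 : 'rV[R]_d) | _ < n] => //= i.
  rewrite tnth_mktuple /unit_ball /norm2 /= big1 ?sqrtr0// => j _.
  by rewrite mxE expr0n.
by apply: integral_ge0 => w _; rewrite lee_fin.
Qed.

Lemma statistical_risk_le (p : probability 'rV[R]_d R) :
  p (@cube R d) = 1%E -> (0 < n)%N ->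
  (statistical_risk prot p <= (2 / n%:R)%:E + 2%:E * worst_mse prot)%E.
Proof.
move=> pcube n0; apply: (iid_risk_le n0 pcube measurable_estimate) => X XS.
by apply: ereal_sup_ubound; exists X.
Qed.

End protocol_risk.

Theorem theorem5 (R : realType) (d : nat) (hd : (0 < d)%N) (t : R) (ht : 0 < t)
    (hZ : property_Z d t) (n : nat) (hn : 4 / t <= n%:R)
    (c : R) (hc0 : 0 < c) (hc : c <= n%:R * d%:R * t / 4) :
  ((t / 4 * Num.min 1 (d%:R / c))%:E <= minimax_mse n d c)%E.
Proof.
have n0 : 0 < n%:R :> R by apply: lt_le_trans hn; rewrite divr_gt0.
have n0' : (0 < n)%N by move: n0; rewrite ltr0n.
have d0 : 0 < d%:R :> R by rewrite ltr0n.
apply: le_ereal_inf_tmp => _ [prot costc <-].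
case: hZ => Pd [Pcube /(_ n prot n0') risk].
have {}risk : ((t * Num.min 1 (d%:R / c))%:E <=
    (2 / n%:R)%:E + 2%:E * worst_mse prot)%E.
  apply: le_trans (le_trans risk _); last first.
    apply: ub_ereal_sup => _ [p Pp <-].
    exact: statistical_risk_le (Pcube _ Pp) n0'.
  (* The cost is at most [c] and inversion is antitone on nonnegative extended reals, so replacing
     the cost by [c] weakens the bound. *)
  rewrite EFinM lee_pmul2l// EFin_min le_min ge_min lexx/=.
  rewrite ge_min; apply/orP; right.
  rewrite EFinM lee_pmul2l// (_ : (c^-1)%:E = (c%:E)^-1%E).
    by rewrite lee_pV2 ?inE ?comm_cost_ge0// lee_fin ltW.
  (* The inverse of 0 is +oo in [\bar R] but 0 in [R]; the two agree here since [c] is nonzero. *)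
  by rewrite inver gt_eqF.
have min_n : 1 / n%:R <= t / 4 * Num.min 1 (d%:R / c).
  rewrite ler_pdivrMr//; move: hn; rewrite ler_pdivrMr// => hn.
  (* If the minimum is 1 this is the bound 4/t on [n]; otherwise, after multiplying by [c], it is
     [hc]. *)
  case: (leP 1 (d%:R / c)) => _; first by lra.
  rewrite -(ler_pM2r hc0) mul1r (_ : _ * _ * c = n%:R * d%:R * t / 4)//.
  by field; rewrite gt_eqF.
(* For a finite error [w], [min_n] absorbs 2/n into half of the left side, leaving 2w at least the
   other half. The value -oo contradicts [risk]. *)
move: risk; case: (worst_mse prot) => [w| |].
- rewrite -EFinM -EFinD !lee_fin; lra.
- by rewrite leey.
- by rewrite gt0_muleNy ?lte_fin// addeNy leeNy_eq.
Qed.
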